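(* Let $S,T$ be two $n$-SLTM, both in the first reduced echelon form ($1$-REF). If $S\sim T$, then $\mathbb{W}(S)=\mathbb{W}(T)$.
   Context: Let $\mathbb{F}$ be a field of characteristic different from $2$. An $n$-SLTM is a strictly lower triangular $n\times n$ matrix with entries in $\mathbb{F}$; $0_n$ is the zero matrix. For an $n$-SLTM $T=[t_{ij}]$, $\mathcal{A}(T)$ is the commutative unital $\mathbb{F}$-algebra with generators $X_1,\dots,X_n$ and relations $X_1^2=0$ and $X_i^2=\sum_{j<i}t_{ij}X_jX_i$ for $2\le i\le n$, graded by $\deg(X_i)=2$. For two $n$-SLTM $T,S$, write $T\sim S$ if there is a degree-preserving isomorphism of $\mathbb{F}$-algebras $\mathcal{A}(T)\to\mathcal{A}(S)$; this is an equivalence relation. Intervals are intervals of integers: $[a,b]=\{m:a\le m\le b\}$, $[a,b[=\{m:a\le m<b\}$, $]a,b]=\{m:a<m\le b\}$. For an $n$-SLTM $T$, $T^{[r]}$ is its $r$-th row. For $r\in[1,n]$ let $c_r=\max\{j:t_{rj}\ne 0\}$ if $T^{[r]}\neq 0$ and $c_r=0$ otherwise. If $c_r>0$, the entry $t_{r,c_r}$ is the leader of the $r$-th row and $(r,c_r)$ is its leader position. For $\alpha\in\mathbb{F}$ and $1\le i<j<k\le n$ put $\Delta^{(\alpha)}_{i,j,k}(T)=\alpha t_{ki}+t_{kj}t_{ji}$. First reduced echelon form ($1$-REF): an $n$-SLTM $S\ne 0_n$ is in $1$-REF if (1) all zero rows of $S$ are above all nonzero rows; (2) for each leader position $(r,c)$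 we have $c>1$ and there is $i_0\in[1,c[$ with $\Delta^{(2)}_{i_0,c,r}(S)\neq 0$; (3) if $(r,c_r)$ and $(r+1,c_{r+1})$ are leader positions of rows $r$ and $r+1$, then $c_r\le c_{r+1}$. The zero matrix $0_n$ is also in $1$-REF. Wall: for $S\neq 0_n$ in $1$-REF define recursively $r_1=\min\{r\in[1,n]:S^{[r]}\ne 0\}$ and, given $r_j$, let $A_j=\{r\in\,]r_j,n]: c_r\ge r_j\}$; if $A_j\neq\emptyset$ put $r_{j+1}=\min(A_j)$; if $A_j=\emptyset$ stop and define the wall of $S$ as the vector $\mathbb{W}(S)=(r_1,\dots,r_j)$. Also $\mathbb{W}(0_n)=(0)$. *)

(* Defs.v *)
From HB Require Import structures.
From Stdlib Require Import ClassicalEpsilon.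
From mathcomp Require Import all_boot all_order all_algebra.
From mathcomp Require Import generic_quotient ring_quotient.
From mathcomp Require Import mpoly.

Set Implicit Arguments.
Unset Strict Implicit.
Unset Printing Implicit Defensive.

Import GRing.Theory.
Local Open Scope ring_scope.
Local Open Scope quotient_scope.

(* Rows and columns are indexed by 'I_n, so the ordinal i stands for the index *)
(* i.+1 in [1, n].  All values of type nat computed below (the column numbers  *)
(* c_r, the entries of the wall) are 1-based, 0 being a distinguished value.   *)

Definition sltm (F : fieldType) (n : nat) (T : 'M[F]_n) : Prop :=
  forall i j : 'I_n, (i <= j)%N -> T i j = 0.

Section Algebra.

Variables (F : fieldType) (n : nat) (T : 'M[F]_n).

(* For the first index the sum is empty and the relation reads X_1 ^ 2 = 0. *)
Definition rel_poly (i : 'I_n) : {mpoly F[n]} :=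
  'X_i ^+ 2 - \sum_(j < n | (j < i)%N) T i j *: ('X_j * 'X_i).

Definition in_rel_ideal (p : {mpoly F[n]}) : Prop :=
  exists a : 'I_n -> {mpoly F[n]}, p = \sum_i a i * rel_poly i.

Definition rel_ideal (p : {mpoly F[n]}) : bool :=
  if excluded_middle_informative (in_rel_ideal p) then true else false.

Lemma rel_idealP p : reflect (in_rel_ideal p) (rel_ideal p).
Proof.
by rewrite /rel_ideal; case: excluded_middle_informative => h; constructor.
Qed.

Lemma rel_poly_const i : (rel_poly i).@[fun=> 0] = 0.
Proof.
rewrite /rel_poly mevalB rmorphXn /= mevalXU expr0n sub0r (raddf_sum (meval (fun=> 0))).
rewrite big1 ?oppr0 // => j _.
by rewrite [LHS]mevalZ mevalM !mevalXU !mulr0.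
Qed.

Lemma rel_ideal_closed : idealr_closed rel_ideal.
Proof.
split.
- apply/rel_idealP; exists (fun=> 0); rewrite big1 // => i _; exact: mul0r.
- apply/negP => /rel_idealP[a /(congr1 (meval (fun=> 0)))].
  rewrite meval1 (raddf_sum (meval (fun=> 0))) big1 => [/eqP|i _]; first by rewrite oner_eq0.
  by rewrite [LHS]mevalM rel_poly_const mulr0.
- move=> p q r /rel_idealP[a ->] /rel_idealP[b ->]; apply/rel_idealP.
  exists (fun i => p * a i + b i).
  rewrite mulr_sumr -big_split; apply: eq_bigr => i _.
  by rewrite mulrDl mulrA.
Qed.

HB.instance Definition _ := isIdealr.Build {mpoly F[n]} rel_ideal rel_ideal_closed.

Definition rel_idealr : idealr {mpoly F[n]} := rel_ideal.

Definition alg : Type := {ideal_quot rel_idealr}.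

HB.instance Definition _ := GRing.ComNzRing.on alg.

Definition alg_pi (p : {mpoly F[n]}) : alg := \pi_({ideal_quot rel_idealr}) p.

Definition alg_gen (i : 'I_n) : alg := alg_pi 'X_i.

Lemma alg_pi_is_zmod_morphism : zmod_morphism alg_pi.
Proof. exact: (raddfB \pi_({ideal_quot rel_idealr})). Qed.

Lemma alg_pi_is_monoid_morphism : monoid_morphism alg_pi.
Proof.
by split; [exact: (rmorph1 \pi_({ideal_quot rel_idealr}))
          | exact: (rmorphM \pi_({ideal_quot rel_idealr}))].
Qed.

HB.instance Definition _ :=
  GRing.isZmodMorphism.Build {mpoly F[n]} alg alg_pi alg_pi_is_zmod_morphism.
HB.instance Definition _ :=
  GRing.isMonoidMorphism.Build {mpoly F[n]} alg alg_pi alg_pi_is_monoid_morphism.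

Definition alg_scale (c : F) (x : alg) : alg := alg_pi c%:MP * x.

Lemma alg_scaleA a b x : alg_scale a (alg_scale b x) = alg_scale (a * b) x.
Proof. by rewrite /alg_scale mulrA -rmorphM /= -mpolyCM. Qed.
Lemma alg_scale1 : left_id 1 alg_scale.
Proof. by move=> x; rewrite /alg_scale mpolyC1 rmorph1 mul1r. Qed.
Lemma alg_scaleDr : right_distributive alg_scale +%R.
Proof. by move=> c x y; rewrite /alg_scale mulrDr. Qed.
Lemma alg_scaleDl x : {morph alg_scale^~ x : a b / a + b}.
Proof. by move=> a b; rewrite /alg_scale mpolyCD rmorphD mulrDl. Qed.

HB.instance Definition _ := GRing.Zmodule_isLmodule.Build F alg
  alg_scaleA alg_scale1 alg_scaleDr alg_scaleDl.

Lemma alg_scaleAl (c : F) (x y : alg) : c *: (x * y) = (c *: x) * y.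
Proof. exact: mulrA. Qed.

HB.instance Definition _ := GRing.Lmodule_isLalgebra.Build F alg alg_scaleAl.

Lemma alg_piZ c p : alg_pi (c *: p) = c *: alg_pi p.
Proof. by rewrite -mul_mpolyC rmorphM. Qed.

Lemma alg_gen_sqr i :
  alg_gen i ^+ 2 = \sum_(j < n | (j < i)%N) T i j *: (alg_gen j * alg_gen i).
Proof.
have /eqP : alg_pi (rel_poly i) == alg_pi 0.
  rewrite -Quotient.idealrBE subr0; apply/rel_idealP.
  exists (fun k => (k == i)%:R).
  rewrite (bigD1 i) //= eqxx mul1r big1 ?addr0 // => k /negPf ->.
  exact: mul0r.
rewrite rmorphB rmorph0 rmorphXn => /subr0_eq ->.
by rewrite raddf_sum; apply: eq_bigr => j _; rewrite [LHS]alg_piZ rmorphM.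
Qed.

(* The component of degree d: every generator has degree 2, hence a monomial  *)
(* m has degree 2 * mdeg m.                                                    *)
Definition alg_homog (d : nat) (x : alg) : Prop :=
  exists2 p : {mpoly F[n]},
    {in msupp p, forall m, (2 * mdeg m)%N = d} & x = alg_pi p.

End Algebra.

Definition alg_equiv (F : fieldType) (n : nat) (T S : 'M[F]_n) : Prop :=
  exists f : {lrmorphism alg T -> alg S},
    bijective f /\
    forall (d : nat) (x : alg T), alg_homog d x -> alg_homog d (f x).

Section EchelonForm.

Variables (F : fieldType) (n : nat).
Implicit Types (S T : 'M[F]_n) (r : 'I_n).

(* The number c_r; the empty maximum is 0. *)
Definition lead T r : nat := (\max_(j < n | (T r j != 0)%R) j.+1)%N.

Definition leader_position T (r c : 'I_n) : Prop := lead T r = c.+1.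

Definition Delta (a : F) (i j k : 'I_n) T : F := a * T k i + T k j * T j i.

Definition ref1_nonzero S : Prop :=
  [/\ forall r r' : 'I_n, row r S = 0 -> row r' S <> 0 -> (r < r')%N,
      forall r c : 'I_n, leader_position S r c ->
        (1 < c.+1)%N /\
        exists2 i0 : 'I_n, (i0 < c)%N & Delta 2%:R i0 c r S <> 0
    & forall r r' c c' : 'I_n, r' = r.+1 :> nat ->
        leader_position S r c -> leader_position S r' c' -> (c <= c')%N].

Definition ref1 S : Prop := S = 0 \/ (S <> 0 /\ ref1_nonzero S).

Definition omin (A : {set 'I_n}) : option 'I_n :=
  [pick r in A | [forall s in A, (r <= s)%N]].

(* The set A_j attached to r_j = k.+1. *)
Definition wall_next S (k : 'I_n) : {set 'I_n} :=
  [set r : 'I_n | (k < r)%N & (k.+1 <= lead S r)%N].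

Fixpoint wall_rec S (fuel : nat) (k : 'I_n) : seq nat :=
  if fuel is m.+1 then
    k.+1 :: (if omin (wall_next S k) is Some k' then wall_rec S m k' else [::])
  else [::].

(* The fuel n is never exhausted: see wall_fromE. *)
Definition wall_from S (k : 'I_n) : seq nat := wall_rec S n k.

(* There is no nonzero row exactly when S = 0. *)
Definition wall S : seq nat :=
  if omin [set r : 'I_n | row r S != 0] is Some r1 then wall_from S r1
  else [:: 0%N].

Lemma wall_rec_fuel S m1 m2 (k : 'I_n) :
  (n - k <= m1)%N -> (n - k <= m2)%N -> wall_rec S m1 k = wall_rec S m2 k.
Proof.
have n_gt0 (i : 'I_n) : (0 < n - i)%N by rewrite subn_gt0.
elim: m1 m2 k => [|m1 IH] [|m2] k; rewrite ?leqn0 ?eqn0Ngt ?n_gt0 // => h1 h2.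
congr (_ :: _); rewrite /omin; case: pickP => // k' /andP[].
rewrite inE => /andP[lt_kk' _] _.
have lt_nk : (n - k' < n - k)%N by apply: ltn_sub2l.
by apply: IH; rewrite -ltnS; [apply: leq_trans h1 | apply: leq_trans h2].
Qed.

Lemma wall_fromE S k :
  wall_from S k =
  k.+1 :: (if omin (wall_next S k) is Some k' then wall_from S k' else [::]).
Proof.
by rewrite {1}/wall_from (@wall_rec_fuel S n n.+1) ?leqW ?leq_subr.
Qed.

End EchelonForm.

(* Main.v *)
(* Let r_1 < r_2 < ... be the wall of an echelon matrix S and U_k the span of
   the X_i with i < r_k, so that U_0 = 0 when r_0 = 1.  Then U_{k+1} is the
   span of the degree 2 elements x such that x^2 belongs to x U_k: each X_i
   with i < r_{k+1} is of this kind since c_i < r_k, and condition (2) of the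
   echelon form excludes the elements with a top index at least r_{k+1}.  Hence
   a graded isomorphism preserves every U_k, and the wall is read off the
   dimensions r_k - 1. *)
From HB Require Import structures.
Require Import Defs.
From mathcomp Require Import all_boot all_order all_algebra.
From mathcomp Require Import ring_quotient mpoly ring.
Local Open Scope ring_scope.

Set Implicit Arguments.
Unset Strict Implicit.
Unset Printing Implicit Defensive.

Import GRing.Theory.

(** * Linear forms and Taylor coefficients at 0 *)

Section LinearForms.

Variables (F : fieldType) (n : nat).
Implicit Types (v w : 'rV[F]_n) (p q : {mpoly F[n]}) (T : 'M[F]_n).

Definition linform v : {mpoly F[n]} := \sum_j v 0 j *: 'X_j.

Lemma linform_is_linear : linear linform.
Proof.
move=> c v w; rewrite /linform scaler_sumr -big_split; apply: eq_bigr => j _.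
by rewrite !mxE scalerDl scalerA.
Qed.

HB.instance Definition _ :=
  GRing.isLinear.Build F 'rV[F]_n {mpoly F[n]} _ linform linform_is_linear.

Lemma linform_delta i : linform (delta_mx 0 i) = 'X_i.
Proof.
rewrite /linform (bigD1 i) //= big1 => [|j /negPf ji].
  by rewrite mxE !eqxx scale1r addr0.
by rewrite mxE ji andbF scale0r.
Qed.

Lemma mcoeff_linform v m :
  (linform v)@_m = \sum_j v 0 j * (U_(j)%MM == m)%:R.
Proof.
by rewrite /linform raddf_sum; apply: eq_bigr => j _; rewrite /= mcoeffZ mcoeffX.
Qed.

Lemma mcoeff_linformU v i : (linform v)@_(U_(i)) = v 0 i.
Proof.
rewrite mcoeff_linform (bigD1 i) //= eqxx mulr1 big1 ?addr0 // => j ji.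
by rewrite eq_mnm1 (negPf ji) mulr0.
Qed.

Lemma homog1_linform p :
  {in msupp p, forall m, mdeg m = 1%N} -> p = linform (\row_j p@_U_(j)).
Proof.
move=> p1; apply/mpolyP => m.
have [/eqP/mdeg1P[i /eqP ->]|m1] := eqVneq (mdeg m) 1%N.
  by rewrite mcoeff_linformU mxE.
rewrite mcoeff_linform big1 => [|j _].
  by apply/eqP; rewrite mcoeff_eq0; apply: contra m1 => /p1 ->.
by have [jm|_] := eqVneq U_(j)%MM m; [rewrite -jm mdeg1 in m1 | rewrite mulr0].
Qed.

Lemma mderiv_linform i v : (linform v)^`M(i) = (v 0 i)%:MP.
Proof.
rewrite /linform raddf_sum (bigD1 i) //= big1 => [|j ji].
  have U0 : (U_(i) - U_(i))%MM = 0%MM :> 'X_{1..n}.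
    by apply/mnmP => k; rewrite mnmBE subnn mnm0E.
  by rewrite mderivZ mderivX mnm1E eqxx U0 scale1r mpolyX0 alg_mpolyC addr0.
by rewrite mderivZ mderivX mnm1E (negPf ji) scale0r scaler0.
Qed.

Definition at0 p : F := p.@[fun=> 0].

Lemma at0_linform v : at0 (linform v) = 0.
Proof.
rewrite /at0 /linform (raddf_sum (meval (fun=> 0))) big1 // => j _.
by rewrite /= mevalZ mevalXU mulr0.
Qed.

Definition deriv2_at0 i j p : F := at0 p^`M(i)^`M(j).

(** Leibniz rule: as [q] vanishes to order two at 0, only the term differentiating [q] twice
    survives. *)
Lemma deriv2_at0M i j p q :
  at0 q = 0 -> (forall k, at0 q^`M(k) = 0) ->
  deriv2_at0 i j (p * q) = at0 p * deriv2_at0 i j q.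
Proof.
rewrite /deriv2_at0 /at0 => q0 dq0.
by rewrite !(mderivM, mderivD, mevalM, mevalD) q0 !dq0 !mulr0 !add0r.
Qed.

Lemma deriv2_at0_linformM i j v w :
  deriv2_at0 i j (linform v * linform w) = v 0 i * w 0 j + v 0 j * w 0 i.
Proof.
rewrite /deriv2_at0 mderivM mderivD !mderivM !mderiv_linform !mderivC /at0.
rewrite !mevalD !mevalM !meval0 !mevalC -!/(at0 _) !at0_linform.
by rewrite !(mulr0, mul0r, add0r, addr0).
Qed.

(** Strict triangularity lets the sum run over all [j], so the relation splits into two linear
    factors. *)
Lemma rel_polyE T i : sltm T ->
  rel_poly T i =
    linform (delta_mx 0 i - row i T) * linform (delta_mx 0 i).
Proof.
move=> sT; rewrite linearB /= linform_delta mulrBl -expr2 /rel_poly; congr (_ - _).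
rewrite big_distrl /= [RHS](bigID (fun j : 'I_n => j < i)%N) /=.
rewrite [X in _ = _ + X]big1 ?addr0.
  by apply: eq_bigr => j _; rewrite mxE scalerAl.
by move=> j; rewrite -leqNgt mxE => /(sT _ _) ->; rewrite scale0r mul0r.
Qed.

(** * Vanishing of linear forms and their products in [alg T] *)

Section InAlgebra.

Variable T : 'M[F]_n.
Hypothesis sT : sltm T.

Lemma at0_rel_poly i : at0 (rel_poly T i) = 0.
Proof. by rewrite rel_polyE // /at0 mevalM -!/(at0 _) !at0_linform mulr0. Qed.

Lemma at0_deriv_rel_poly i k : at0 (rel_poly T i)^`M(k) = 0.
Proof.
rewrite rel_polyE // mderivM /at0 mevalD !mevalM -!/(at0 _) !at0_linform.
by rewrite mulr0 mul0r addr0.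
Qed.

Lemma alg_pi_eq0 p : alg_pi T p = 0 -> in_rel_ideal T p.
Proof.
move=> p0; apply/rel_idealP.
have : alg_pi T p == alg_pi T 0 by rewrite p0 rmorph0.
by rewrite -Quotient.idealrBE subr0.
Qed.

(** The relations vanish to order two at 0, so no element of the ideal has a linear term. *)
Lemma alg_pi_linform_eq0 v : alg_pi T (linform v) = 0 -> v = 0.
Proof.
case/alg_pi_eq0 => a va; apply/rowP => j; rewrite mxE.
have := congr1 (fun p => at0 p^`M(j)) va.
rewrite mderiv_linform /at0 mevalC => ->.
rewrite (raddf_sum (mderiv j)) (raddf_sum (meval (fun=> 0))) big1 // => i _.
rewrite /= mderivM mevalD !mevalM -!/(at0 _) at0_rel_poly at0_deriv_rel_poly.
by rewrite !mulr0 addr0.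
Qed.

(* In the basis (X_j X_i)_(j < i), the coefficient of X_j X_i in the product
   collects, besides its own, T i j times the coefficient of X_i ^ 2. *)
Lemma alg_pi_linformM_eq0 v w (i j : 'I_n) : 2%:R != 0 :> F -> (j < i)%N ->
  alg_pi T (linform v * linform w) = 0 ->
  v 0 i * w 0 j + v 0 j * w 0 i + T i j * (v 0 i * w 0 i) = 0.
Proof.
move=> two_neq0 ji /alg_pi_eq0[a vwa].
(* [deriv2_at0 i i] is twice the coefficient of the square, so the mixed term is doubled to match;
   [psi] kills the ideal, and the factor 2 is cancelled at the end. *)
pose psi p := deriv2_at0 i j p *+ 2 + T i j * deriv2_at0 i i p.
have psi_sum (I : finType) (G : I -> {mpoly F[n]}) :
    psi (\sum_k G k) = \sum_k psi (G k).
  rewrite /psi /deriv2_at0 /at0 (raddf_sum (mderiv i)) /=.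
  rewrite (raddf_sum (mderiv i)) (raddf_sum (mderiv j)) /=.
  by rewrite !(raddf_sum (meval (fun=> 0))) /= -sumrMnl mulr_sumr -big_split.
have : psi (linform v * linform w) = 0.
  rewrite vwa psi_sum big1 // => k _.
  rewrite /psi !deriv2_at0M; try exact: at0_rel_poly; try exact: at0_deriv_rel_poly.
  rewrite rel_polyE // !deriv2_at0_linformM !mxE !eqxx /=.
  have [<-|ik] := eqVneq i k.
    by rewrite (ltn_eqF ji : (j == i) = false) (sT (leqnn i)) /=; ring.
  have [<-|jk] := eqVneq j k; last by rewrite /=; ring.
  by rewrite (sT (ltnW ji)) /=; ring.
rewrite /psi !deriv2_at0_linformM => vw0.
by apply: (mulfI two_neq0); rewrite mulr0 -vw0; ring.
Qed.

End InAlgebra.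

(* The matrix M is the action on the generators of a homomorphism
   alg S -> alg T, generators being row vectors of the standard basis. *)
Definition alg_mx (S T M : 'M[F]_n) : Prop := forall i,
  alg_pi T (linform ((delta_mx 0 i - row i S) *m M) *
            linform (delta_mx 0 i *m M)) = 0.

Lemma alg_pi_rel_poly T i : sltm T ->
  alg_pi T (linform (delta_mx 0 i - row i T) * linform (delta_mx 0 i)) = 0.
Proof.
move=> sT; rewrite -rel_polyE // rmorphB rmorphXn /= -/(alg_gen T i).
rewrite alg_gen_sqr raddf_sum /= -sumrB big1 // => j _.
by rewrite alg_piZ rmorphM subrr.
Qed.

(** The isomorphism preserves degree 2, so it sends generators to linear forms, whose coefficients
    are the rows of [M]. *)
Lemma alg_equiv_mx (S T : 'M[F]_n) : sltm S -> sltm T -> alg_equiv S T ->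
  exists2 M, M \in unitmx & alg_mx S T M /\ alg_mx T S (invmx M).
Proof.
move=> sS sT [f [bij_f homog_f]].
have inj_f := bij_inj bij_f.
have gen_f i : exists v, f (alg_gen S i) = alg_pi T (linform v).
  have /homog_f[p p1 ->] : alg_homog 2 (alg_gen S i).
    by exists 'X_i => // m; rewrite msuppX inE => /eqP ->; rewrite mdeg1.
  exists (\row_j p@_U_(j)); congr alg_pi; apply: homog1_linform => m /p1.
  by rewrite -[RHS]/(2 * 1)%N => /eqP; rewrite eqn_mul2l => /eqP.
have [g gE] := fin_all_exists gen_f.
pose M := \matrix_i g i.
have fE v : f (alg_pi S (linform v)) = alg_pi T (linform (v *m M)).
  rewrite mulmx_sum_row (linear_sum linform) [linform v]/linform.
  rewrite (raddf_sum (alg_pi S)) (raddf_sum f) (raddf_sum (alg_pi T)) /=.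
  apply: eq_bigr => j _; rewrite alg_piZ linearZ /= gE rowK.
  by rewrite linearZ alg_piZ.
have uM : M \in unitmx.
  rewrite -row_free_unit; apply/row_freeP.
  apply/row_freeP; rewrite -kermx_eq0; apply/eqP/row_matrixP => i; rewrite row0.
  apply: (alg_pi_linform_eq0 sS); apply: inj_f.
  by rewrite fE rmorph0 -row_mul mulmx_ker row0 linear0 rmorph0.
exists M => //; split=> i.
  by rewrite rmorphM /= -!fE -!rmorphM /= alg_pi_rel_poly ?rmorph0.
(* The relations for [invmx M] are tested after applying [f], which multiplies by [M] and leaves the
   relations of [T]. *)
apply: inj_f; rewrite rmorph0 rmorphM rmorphM /= !fE -!mulmxA mulVmx // !mulmx1.
by rewrite -rmorphM /= alg_pi_rel_poly.
Qed.

End LinearForms.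

(** * Leaders in echelon form and block matrices *)

Section Echelon.

Variables (F : fieldType) (n : nat).
Implicit Types (S T M N : 'M[F]_n) (A : {set 'I_n}) (r p q : 'I_n) (d e : nat).

(* The value n stands for a missing next row. *)
Definition ob (o : option 'I_n) : nat := if o is Some k then k else n.

Lemma ob_omin_le A r : r \in A -> (ob (omin A) <= r)%N.
Proof.
rewrite /omin; case: pickP => [k /andP[_ /forall_inP kA] /kA //|noA rA].
have := noA [arg min_(i < r in A) i].
by case: arg_minnP => //= i -> /(_ _)/implyP iA /negP[]; apply/forallP => s; apply: iA.
Qed.

Lemma omin_mem A k : omin A = Some k -> k \in A.
Proof. by rewrite /omin; case: pickP => // r /andP[rA _] [<-]. Qed.

Lemma ob_inj : injective ob.
Proof.
move=> [k|] [k'|] //= kk'; first by congr Some; apply: val_inj.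
  by have := ltn_ord k; rewrite kk' ltnn.
by have := ltn_ord k'; rewrite -kk' ltnn.
Qed.

Lemma ob_le o : (ob o <= n)%N.
Proof. by case: o => [k|] //=; rewrite ltnW. Qed.

Lemma lead_le T r : sltm T -> (lead T r <= r)%N.
Proof.
move=> sT; apply/bigmax_leqP => j; rewrite ltnNge; apply: contra => rj.
by rewrite (sT _ _ rj).
Qed.

Lemma lead_eq0 T r (j : 'I_n) : (lead T r <= j)%N -> T r j = 0.
Proof.
move=> lj; apply/eqP; apply: contraLR lj => Trj; rewrite -ltnNge.
exact: (@leq_bigmax_cond _ (fun k => T r k != 0) (fun k => k.+1)).
Qed.

Lemma leadP T r : (0 < lead T r)%N ->
  exists2 c : 'I_n, leader_position T r c & T r c != 0.
Proof.
rewrite /leader_position /lead.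
case: (pickP (fun j => T r j != 0)) => [j Trj _|T0]; last by rewrite big_pred0.
rewrite (bigmax_eq_arg j (P := fun j => T r j != 0)) //.
by case: arg_maxnP => // c Trc _; exists c.
Qed.

Lemma lead_gt0 T r : (0 < lead T r)%N = (row r T != 0).
Proof.
apply/idP/idP => [/leadP[c _]|].
  by apply: contra => /eqP/rowP/(_ c); rewrite !mxE => ->.
rewrite lt0n; apply: contra => /eqP l0; apply/eqP/rowP => j.
by rewrite !mxE lead_eq0 ?l0.
Qed.

(** Condition (3) only compares adjacent nonzero rows; condition (1) excludes zero rows below a
    nonzero one, so induction on [s - r] works. *)
Lemma ref1_lead_mono T r (s : 'I_n) : ref1 T -> (r <= s)%N -> (lead T r <= lead T s)%N.
Proof.
have [->|r_gt0] := posnP (lead T r); first by [].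
case=> [T0|[_ [zero_above _ lead_le_succ]]].
  by move: r_gt0; rewrite lead_gt0 T0 row0 eqxx.
move=> /subnK; move: (s - r)%N => m; elim: m s => [|m IH] s sE.
  by rewrite (_ : r = s) //; apply: val_inj.
have lt_mn : (m + r < n)%N by apply: leq_trans (ltn_ord s); rewrite -sE.
pose s' := Ordinal lt_mn; have rs' : (lead T r <= lead T s')%N by apply: IH.
apply: leq_trans rs' _.
have s'_gt0 : (0 < lead T s')%N by apply: leq_trans (IH s' _).
have s_gt0 : (0 < lead T s)%N.
  rewrite lead_gt0; apply/eqP => s0; move: s'_gt0; rewrite lead_gt0 => /eqP.
  by move=> /(zero_above _ _ s0); rewrite -sE /= ltnNge leqnSn.
have [c lc _] := leadP s'_gt0; have [c' lc' _] := leadP s_gt0.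
by rewrite lc lc' ltnS (lead_le_succ s' s).
Qed.

(** One step of the wall with [d] standing for r_j - 1; [d = 0] yields the first entry. *)
Definition next T d : option 'I_n := omin [set r | (d < lead T r)%N].

Lemma lead_before_next T d r : (r < ob (next T d))%N -> (lead T r <= d)%N.
Proof.
rewrite [(lead T r <= d)%N]leqNgt; apply: contraL => dr; rewrite -leqNgt.
by apply: ob_omin_le; rewrite inE.
Qed.

Lemma lead_from_next T d r :
  ref1 T -> (ob (next T d) <= r)%N -> (d < lead T r)%N.
Proof.
move=> refT; case Ek: (next T d) => [k|] /=; last by rewrite leqNgt ltn_ord.
by have := omin_mem Ek; rewrite inE => dk /(ref1_lead_mono refT); apply: leq_trans.
Qed.

(** Acting on row vectors, [M] carries the span of the first [d] basis vectors into that of the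
    first [e]. *)
Definition block d e M : Prop :=
  forall p q, (p < d)%N -> (e <= q)%N -> M p q = 0.

(* If [x] is the image of a generator X_p with p < next S d, then x^2 = w x
   with w in the span of X_q, q < d.  If the top index r of x is at least
   next T d, the leader position (r, c) has c >= d; comparing the coefficients
   of X_c X_r and X_j X_r, X_j X_c for j < c forces Delta 2 j c r = 0 for
   every j, against condition (2) of the echelon form. *)
Lemma block_step S T M d : 2%:R != 0 :> F -> sltm T -> ref1 T ->
  alg_mx S T M -> block d d M -> block (ob (next S d)) (ob (next T d)) M.
Proof.
move=> two_neq0 sT refT relM Md p q p_lt q_ge; apply/eqP; apply: contraT => Mpq.
have lt_d_lead := lead_from_next refT.
pose P := [pred r : 'I_n | M p r != 0].
case: (@arg_maxnP _ q P val Mpq) => r Mpr r_max.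
have r_ge : (ob (next T d) <= r)%N by apply: leq_trans (r_max q Mpq).
have /lt_d_lead dr := r_ge.
have [c lc Trc] := leadP (leq_ltn_trans (leq0n d) dr).
have dc : (d <= c)%N by move: dr; rewrite lc.
have cr : (c < r)%N by rewrite -lc; apply: lead_le.
have dltr : (d <= r)%N := leq_trans dc (ltnW cr).
have [w wE w_eq0] : exists2 w : 'rV_n, w = row p S *m M &
    forall j : 'I_n, (d <= j)%N -> w 0 j = 0.
  exists (row p S *m M) => // j dj; rewrite mxE big1 // => k _; rewrite mxE.
  have [kd|dk] := ltnP k d; first by rewrite Md ?mulr0.
  by rewrite lead_eq0 ?mul0r //; apply: leq_trans dk; apply: lead_before_next.
(* The coefficient of X_j X_i in x (x - w) = 0, divided by [M p i]. *)
have relE (i j : 'I_n) : (d <= i)%N -> (j < i)%N -> M p i != 0 ->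
    M p j + (M p j - w 0 j) + T i j * M p i = 0.
  move=> di ji Mpi; have := alg_pi_linformM_eq0 sT two_neq0 ji (relM p).
  rewrite mulmxBl -wE -!rowE !mxE (w_eq0 i di) subr0 => relij.
  by apply: (mulfI Mpi); rewrite mulr0 -relij; ring.
have Mc := relE r c dltr cr Mpr; rewrite (w_eq0 c dc) subr0 in Mc.
have Mpc : M p c != 0.
  apply: contra_eq_neq Mc => ->; rewrite addr0 add0r.
  by rewrite mulf_neq0.
case: refT => [T0|[_ [_ delta_neq0 _]]]; first by rewrite T0 mxE eqxx in Trc.
have [_ [j jc []]] := delta_neq0 r c lc; apply: (mulfI Mpr).
have Mrj := relE r j dltr (ltn_trans jc cr) Mpr.
have Mcj := relE c j dc jc Mpc.
(* The equations at (r, j) and (c, j) share the part 2 x_j - w_j, which cancels. *)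
have TM : T r j * M p r = T c j * M p c.
  by move: Mrj; rewrite -Mcj => /addrI.
rewrite mulr0 /Delta mulrDr mulrCA [M p r * T r j]mulrC TM.
by rewrite -[RHS](mulr0 (T c j)) -Mc; ring.
Qed.

(** An injective map cannot send a space of dimension [d] into one of smaller dimension. *)
Lemma block_le d e M :
  M \in unitmx -> (d <= n)%N -> (e <= n)%N -> block d e M -> (d <= e)%N.
Proof.
move=> uM dn en Mde.
suff: (\rank (pid_mx d *m M : 'M_n) <= \rank (pid_mx e : 'M[F]_n))%N.
  by rewrite mxrankMfree ?row_free_unit // !rank_pid_mx.
rewrite (_ : pid_mx d *m M = pid_mx d *m M *m pid_mx e); first exact: mxrankM_maxr.
apply/matrixP => p q; rewrite [RHS]mxE (bigD1 q) //= [pid_mx e q q]mxE eqxx /=.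
rewrite big1 ?addr0 => [|k /negPf kq]; last first.
  by rewrite [pid_mx e _ _]mxE [_ == _]kq mulr0.
have [qe|eq] := ltnP q e; rewrite ?mulr1 // mulr0 mxE big1 // => k _.
rewrite mxE; have [->|_] := eqVneq (p : nat) k; last by rewrite mul0r.
by have [kd|_] := ltnP k d; rewrite ?mul0r // Mde ?mulr0.
Qed.

(** * Comparison of the two walls *)

Section Wall.

Variables (S T M : 'M[F]_n).
Hypotheses (two_neq0 : 2%:R != 0 :> F) (sS : sltm S) (sT : sltm T).
Hypotheses (refS : ref1 S) (refT : ref1 T) (uM : M \in unitmx).
Hypotheses (relM : alg_mx S T M) (relV : alg_mx T S (invmx M)).

(** [M] and its inverse give opposite inequalities between the next rows; once these agree, the
    blocks are square again. *)
Lemma next_eq d : block d d M -> block d d (invmx M) ->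
  let e := ob (next S d) in
  [/\ next S d = next T d, block e e M & block e e (invmx M)].
Proof.
move=> Md Vd e.
have MST := block_step two_neq0 sT refT relM Md.
have VTS := block_step two_neq0 sS refS relV Vd.
have ST : next S d = next T d.
  apply: ob_inj; apply/eqP; rewrite eqn_leq.
  rewrite (block_le uM (ob_le _) (ob_le _) MST).
  by rewrite (block_le _ (ob_le _) (ob_le _) VTS) ?unitmx_inv.
by rewrite /e -ST in MST VTS *.
Qed.

Lemma wall_next_omin T' (k : 'I_n) : sltm T' -> omin (wall_next T' k) = next T' k.
Proof.
move=> sT'; congr omin; apply/setP => r; rewrite !inE andb_idl // => /leq_trans.
by apply; apply: lead_le.
Qed.

Lemma wall_rec_eq m (k : 'I_n) :
  block k k M -> block k k (invmx M) -> wall_rec S m k = wall_rec T m k.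
Proof.
elim: m k => //= m IH k Mk Vk; rewrite !wall_next_omin //.
have [<- ] := next_eq Mk Vk.
by case: (next S k) => //= k' Mk' Vk'; rewrite IH.
Qed.

Lemma wall_eq : wall S = wall T.
Proof.
(* For [d = 0] both block conditions are vacuous. *)
have [ST] := @next_eq 0 (fun _ _ h => ltac:(by [])) (fun _ _ h => ltac:(by [])).
have nextE T' : omin [set r | row r T' != 0] = next T' 0.
  by congr omin; apply/setP => r; rewrite !inE lead_gt0.
rewrite /wall !nextE -ST; case: (next S 0) => //= k; exact: wall_rec_eq.
Qed.

End Wall.

End Echelon.

Theorem theorem3p23 (F : fieldType) (charF : 2%N \notin [pchar F])
    (n : nat) (S T : 'M[F]_n)
    (sltmS : sltm S) (sltmT : sltm T) (refS : ref1 S) (refT : ref1 T)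
    (ST : alg_equiv S T) :
  wall S = wall T.
Proof.
have two_neq0 : 2%:R != 0 :> F by move: charF; rewrite inE.
have [M uM [relM relV]] := alg_equiv_mx sltmS sltmT ST.
exact: (wall_eq two_neq0 sltmS sltmT refS refT uM relM relV).
Qed.
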